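(* Let $t,m\in\mathbb{N}$ (positive integers). Using Gauss diagrams on $\mathbb{R}$, the rank $\rho_t[m]$ of the abelian group $\vec{\mathscr{X}}_t[m]$ satisfies $$\frac{t+1}{m}\binom{m+t}{1+t}\le\rho_t[m]\le\Omega_t[m],$$ where $$\begin{aligned}\Omega_t[m]={}&4m+(2t-1)!!\,2^t(m+1)^t-\sum_{j=1}^{\lfloor\frac{2t+1}{3}\rfloor}\binom{2(t-j)+1}{j}(2(t-j)-1)!!\,2^t m^{t-j}\\&+\sum_{k=2}^{t-1}(2k-1)!!\,2^{2k}(m+1)^k-\sum_{k=2}^{t-1}\sum_{j=1}^{\lfloor\frac{2k+1}{3}\rfloor}\binom{2(k-j)+1}{j}(2(k-j)-1)!!\,2^{2k}m^{k-j}.\end{aligned}$$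
   Context: $(-1)!!=1$, and empty sums are $0$. $\vec{\mathscr{A}}[m]$ is the set of signed arrow diagrams on the oriented line $\mathbb{R}$: finitely many arrows with distinct endpoints on the line, each arrow carrying a sign $\oplus/\ominus$ and an arbitrary label in $\{1,\dots,m+1\}$, up to orientation-preserving homeomorphism. An arrow is isolated if its endpoints are consecutive. Relations in $\mathbb{Z}[\vec{\mathscr{A}}[m]]$: $\vec{\mathrm{Q1}}[m]$: $D=0$ if $D$ has an isolated arrow labelled $m+1$. $\vec{\mathrm{Q2}}[m]$: $D+(D\setminus a)+(D\setminus b)=0$ if $a,b$ are arrows of $D$ with opposite signs, equal labels, adjacent tails and adjacent heads. $\vec{\mathrm{Q3}}[m]$: let $1,2,3$ be disjoint intervals of the line (in any order), and let $D$ have three arrows of equal sign $a:1\to2$, $b:1\to3$, $c:2\to3$ whose endpoints occur on interval 1 in the order $a,b$, on interval 2 in the order $a,c$, on interval 3 in the order $b,c$ (no other endpoints on these intervals); let $D'$ be $D$ with the order of the two endpoints reversed on each of the three intervals; the labels $i,j,k$ of $a,b,c$ (the same in $D$ and $D'$) satisfy $i>j=k$, or $j>i=k$, or $k>i=j$, or $i=j=k=m+1$; then $D+(D\setminus a)+(D\setminus b)+(D\setminus c)=D'+(D'\setminus a)+(D'\setminus b)+(D'\setminus c)$. $\vec{A}_t[m]$ is the set of diagrams with more than $t$ arrows, and $\vec{\mathscr{X}}_t[m]=\mathbb{Z}[\vec{\mathscr{A}}[m]]/\langle\vec{\mathrm{Q1}}[m],\vec{\mathrm{Q2}}[m],\vec{\mathrm{Q3}}[m],\vec{A}_t[m]\rangle$.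 *)

(* Defs.v *)
From HB Require Import structures.
From mathcomp Require Import all_boot all_order all_algebra.
From mathcomp Require Import freeg.
From mathcomp Require Import boolp.

Set Implicit Arguments.
Unset Strict Implicit.
Unset Printing Implicit Defensive.

Import Order.TTheory GRing.Theory Num.Theory.
Local Open Scope ring_scope.

(** * Signed arrow diagrams on the oriented line, labelled in {1, ..., m+1} *)

(* A diagram is encoded by its Gauss word: the list of the arrow endpoints in
   the order in which they occur along the line.  An arrow carries a name
   (which only serves to tell arrows apart), a sign (true for a plus) and a
   label, where l : 'I_m.+1 stands for the label l + 1; thus ord_max stands for
   m + 1. *)
Definition arrow (m : nat) := (nat * bool * 'I_m.+1)%type.
Definition name m (a : arrow m) : nat := a.1.1.
Definition sign m (a : arrow m) : bool := a.1.2.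
Definition label m (a : arrow m) : 'I_m.+1 := a.2.

Definition endpoint (m : nat) := (arrow m * bool)%type.
Definition tl m (a : arrow m) : endpoint m := (a, true).
Definition hd m (a : arrow m) : endpoint m := (a, false).

Definition arrows m (w : seq (endpoint m)) : seq (arrow m) :=
  undup (map fst w).

Definition gauss m (w : seq (endpoint m)) : bool :=
  uniq w && all (fun x => (x.1, ~~ x.2) \in w) w.

(* Two Gauss words describe homeomorphic diagrams iff they differ by a
   renaming of the arrows; the canonical word of a class names the arrows
   0, 1, 2, ... in the order of their first endpoints. *)
Definition canonical m (w : seq (endpoint m)) : bool :=
  map (@name m) (arrows w) == iota 0 (size (arrows w)).

Definition rename m (w : seq (endpoint m)) (a : arrow m) : arrow m :=
  (index a (arrows w), sign a, label a).

Definition normalize m (w : seq (endpoint m)) : seq (endpoint m) :=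
  [seq (rename w x.1, x.2) | x <- w].

Definition diagram (m : nat) :=
  {w : seq (endpoint m) | gauss w && canonical w}.

Definition empty_diagram m : diagram m :=
  exist (fun w => gauss w && canonical w) [::] isT.

(* The class of a Gauss word.  The default value is only reached on words that
   are not Gauss words; see val_diagram_of, gauss_remove and gauss_swap. *)
Definition diagram_of m (w : seq (endpoint m)) : diagram m :=
  insubd (empty_diagram m) (normalize w).

Lemma rename_inj m (w : seq (endpoint m)) :
  {in arrows w &, injective (rename w)}.
Proof. by move=> a b aw bw [eq_ab _ _]; exact: (index_inj a aw bw eq_ab). Qed.

Lemma mem_arrows m (w : seq (endpoint m)) x : x \in w -> x.1 \in arrows w.
Proof. by move=> xw; rewrite mem_undup map_f. Qed.

Lemma undup_map_in (T U : eqType) (f : T -> U) (s : seq T) :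
  {in s &, injective f} -> undup (map f s) = map f (undup s).
Proof.
elim: s => //= a s IHs f_inj.
have {}IHs: undup (map f s) = map f (undup s).
  by apply: IHs => x y xs ys; apply: f_inj; rewrite inE ?xs ?ys orbT.
rewrite (_ : (f a \in map f s) = (a \in s)); last first.
  apply/mapP/idP => [[b bs eq_ab]|]; last by exists a.
  by rewrite (f_inj a b) // inE ?eqxx ?bs ?orbT.
by case: ifP; rewrite IHs.
Qed.

Lemma arrows_normalize m (w : seq (endpoint m)) :
  arrows (normalize w) = map (rename w) (arrows w).
Proof.
rewrite /arrows -undup_map_in -?map_comp // => a b aw bw.
by apply: rename_inj; rewrite mem_undup.
Qed.

Lemma gauss_normalize m (w : seq (endpoint m)) :
  gauss w -> gauss (normalize w).
Proof.
case/andP=> w_uniq /allP w_closed; apply/andP; split.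
  rewrite map_inj_in_uniq // => -[a e] [b f] aw bw [].
  move=> eq_ab eq_s eq_l <-; congr (_, _).
  by apply: (@rename_inj m w); rewrite ?(mem_arrows aw, mem_arrows bw) //;
     congr (_, _, _).
apply/allP=> _ /mapP[x xw ->] /=.
by apply/mapP; exists (x.1, ~~ x.2); rewrite ?w_closed.
Qed.

Lemma canonical_normalize m (w : seq (endpoint m)) :
  canonical (normalize w).
Proof.
rewrite /canonical arrows_normalize size_map -map_comp; apply/eqP.
apply: (@eq_from_nth _ 0%N) => [|i]; rewrite !size_map ?size_iota // => lt_i.
have [a _] : exists2 a, a \in arrows w & True.
  by case: (arrows w) lt_i => // a s _; exists a; rewrite ?mem_head.
rewrite (nth_map a) // nth_iota // add0n /= /rename /name /= index_uniq //.
exact: undup_uniq.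
Qed.

Lemma val_diagram_of m (w : seq (endpoint m)) :
  gauss w -> val (diagram_of w) = normalize w.
Proof.
by move=> w_gauss; rewrite val_insubd gauss_normalize ?canonical_normalize.
Qed.

Lemma diagram_ofK m (D : diagram m) : diagram_of (val D) = D.
Proof.
apply: val_inj; case: D => w /= /andP[w_gauss /eqP w_canon].
rewrite val_diagram_of //; rewrite -[RHS]map_id; apply/eq_in_map=> -[a e] aw.
have [aw1 w_uniq] := (mem_arrows aw, undup_uniq (map fst w)).
congr (_, _); rewrite [RHS]surjective_pairing [in RHS]/=.
rewrite [a.1 in RHS]surjective_pairing; congr (_, _, _).
have lt_a : (index a (arrows w) < size (arrows w))%N by rewrite index_mem.
by rewrite -[a in RHS](nth_index a aw1) -/(name _) -(nth_map a 0%N) //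
  w_canon nth_iota.
Qed.

(* The diagram described by w with the arrow a deleted. *)
Definition remove m (w : seq (endpoint m)) (a : arrow m) : diagram m :=
  diagram_of [seq x <- w | x.1 != a].

Lemma gauss_remove m (w : seq (endpoint m)) (a : arrow m) :
  gauss w -> gauss [seq x <- w | x.1 != a].
Proof.
case/andP=> w_uniq /allP w_closed; apply/andP; split; first exact: filter_uniq.
by apply/allP=> x; rewrite !mem_filter => /andP[-> /w_closed].
Qed.

(* Exchange of the endpoints x and y. *)
Definition swap m (x y : endpoint m) (w : seq (endpoint m)) :=
  [seq if z == x then y else if z == y then x else z | z <- w].

Lemma perm_swap m (x y : endpoint m) (w : seq (endpoint m)) :
  uniq w -> x \in w -> y \in w -> perm_eq (swap x y w) w.
Proof.
move=> w_uniq xw yw; pose f z := if z == x then y else if z == y then x else z.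
have fK : involutive f.
  rewrite /f => z; case: (z =P x) => [->|/eqP nzx].
    by rewrite eqxx; case: eqP.
  case: (z =P y) => [->|/eqP nzy]; first by rewrite eqxx.
  by rewrite (negPf nzx) (negPf nzy).
have fw z : z \in w -> f z \in w by rewrite /f; do 2?case: ifP.
apply: uniq_perm => // [|z]; first by rewrite map_inj_uniq //; apply: inv_inj.
apply/mapP/idP => [[u uw ->]|zw]; first exact: fw.
by exists (f z); rewrite ?fw // -/(f _) fK.
Qed.

Lemma gauss_perm m (w w' : seq (endpoint m)) :
  perm_eq w' w -> gauss w -> gauss w'.
Proof.
move=> w'w; rewrite /gauss (perm_uniq w'w) (perm_all _ w'w) => /andP[-> /=].
by congr (is_true _); apply: eq_all => x; rewrite (perm_mem w'w).
Qed.

Lemma gauss_swap m (x y : endpoint m) (w : seq (endpoint m)) :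
  x \in w -> y \in w -> gauss w -> gauss (swap x y w).
Proof.
move=> xw yw w_gauss; apply: gauss_perm (w_gauss).
by apply: perm_swap => //; case/andP: w_gauss.
Qed.

(** * The relations *)

(* x immediately precedes y along the line. *)
Definition next_to m (w : seq (endpoint m)) (x y : endpoint m) : bool :=
  infix [:: x; y] w.

Definition adjacent m (w : seq (endpoint m)) (x y : endpoint m) : bool :=
  next_to w x y || next_to w y x.

Definition isolated m (w : seq (endpoint m)) (a : arrow m) : bool :=
  adjacent w (tl a) (hd a).

Definition Q2_pair m (D : diagram m) (a b : arrow m) : bool :=
  [&& sign a != sign b, label a == label b,
      adjacent (val D) (tl a) (tl b) & adjacent (val D) (hd a) (hd b)].

Definition Q3_labels m (i j k : 'I_m.+1) : bool :=
  [|| (i > j)%N && (j == k), (j > i)%N && (i == k), (k > i)%N && (i == j)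
    | [&& i == j, j == k & k == ord_max]].

(* The three intervals are small neighbourhoods of the three pairs of
   consecutive endpoints; their relative position on the line is free. *)
Definition Q3_triple m (D : diagram m) (a b c : arrow m) : bool :=
  [&& uniq [:: a; b; c], sign a == sign b, sign b == sign c,
      next_to (val D) (tl a) (tl b), next_to (val D) (hd a) (tl c),
      next_to (val D) (hd b) (hd c) & Q3_labels (label a) (label b) (label c)].

(* A Gauss word of D'.  It need not be canonical, so the deletions of arrows
   of D' are computed on it: there a, b and c still denote the same arrows. *)
Definition Q3_word m (D : diagram m) (a b c : arrow m) : seq (endpoint m) :=
  swap (tl a) (tl b) (swap (hd a) (tl c) (swap (hd b) (hd c) (val D))).

Lemma gauss_Q3_word m (D : diagram m) (a b c : arrow m) :
  Q3_triple D a b c -> gauss (Q3_word D a b c).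
Proof.
rewrite /Q3_triple /Q3_word /next_to; case: D => w /= /andP[].
move=> w_gauss _ /and5P[_ _ _ /mem_infix ab /andP[/mem_infix ac]].
case/andP=> /mem_infix bc _; have w_uniq : uniq w by case/andP: w_gauss.
have perm_w x y w' : perm_eq w' w -> x \in w -> y \in w ->
    perm_eq (swap x y w') w.
  move=> w'w xw yw; apply: perm_trans (w'w).
  by apply: perm_swap; rewrite ?(perm_uniq w'w) ?(perm_mem w'w).
apply: gauss_perm (w_gauss); apply: (perm_w); last 2 first.
- by apply: ab; rewrite !inE eqxx.
- by apply: ab; rewrite !inE eqxx orbT.
apply: (perm_w); last 2 first.
- by apply: ac; rewrite !inE eqxx.
- by apply: ac; rewrite !inE eqxx orbT.
by apply: (perm_w); rewrite ?perm_refl //; apply: bc; rewrite !inE eqxx ?orbT.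
Qed.

Inductive relator (t m : nat) : {freeg (diagram m)} -> Prop :=
| Q1 (D : diagram m) (a : arrow m) of
    isolated (val D) a & label a = ord_max : relator t << D >>
| Q2 (D : diagram m) (a b : arrow m) of Q2_pair D a b :
    relator t (<< D >> + << remove (val D) a >> + << remove (val D) b >>)
| Q3 (D : diagram m) (a b c : arrow m) of Q3_triple D a b c :
    let w := val D in let w' := Q3_word D a b c in
    relator t ((<< D >> + << remove w a >> + << remove w b >>
                + << remove w c >>)
               - (<< diagram_of w' >> + << remove w' a >> + << remove w' b >>
                  + << remove w' c >>))
| A_gt (D : diagram m) of (t < size (arrows (val D)))%N : relator t << D >>.

(** * The group X_t[m] and its rank *)

(* Membership in the subgroup generated by the elements satisfying R,
   reflected into bool as required by the library's quotients of Z-modules. *)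
Definition subgroup (V : zmodType) (R : V -> Prop) : {pred V} :=
  fun x => `[< exists2 s : seq (int * V), {in s, forall p, R p.2} &
                 x = \sum_(p <- s) p.2 *~ p.1 >].

Lemma subgroup_zmod_closed (V : zmodType) (R : V -> Prop) :
  zmod_closed (subgroup R).
Proof.
split=> [|_ _ /asboolP[s sR ->] /asboolP[s' s'R ->]]; apply/asboolP.
  by exists [::]; rewrite ?big_nil.
exists (s ++ [seq (- p.1, p.2) | p <- s']) => [p|].
  by rewrite mem_cat => /orP[/sR|/mapP[q /s'R Rq ->]].
rewrite big_cat big_map /= -sumrN; congr (_ + _).
by apply: eq_bigr => p _; rewrite mulrNz.
Qed.

HB.instance Definition _ (V : zmodType) (R : V -> Prop) :=
  GRing.isZmodClosed.Build V (subgroup R) (subgroup_zmod_closed R).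

Definition X (t m : nat) : zmodType :=
  Quotient.quot (subgroup (@relator t m)).

Definition independent (V : zmodType) n (v : 'I_n -> V) : Prop :=
  forall c : 'I_n -> int, \sum_i v i *~ c i = 0 -> forall i, c i = 0.

(* The rank of the abelian group V is r: the maximal number of linearly
   independent elements over the integers. *)
Definition has_rank (V : zmodType) (r : nat) : Prop :=
  (exists v : 'I_r -> V, independent v) /\
  (forall n (v : 'I_n -> V), independent v -> (n <= r)%N).

(** * The upper bound *)

(* (2k - 1)!! = 1 * 3 * ... * (2k - 1), so that (-1)!! = 1 *)
Definition odd_dfact (k : nat) : nat := (\prod_(i < k) i.*2.+1)%N.

Definition Omega (t m : nat) : int :=
  (4 * m)%N%:Z + (odd_dfact t * 2 ^ t * m.+1 ^ t)%N%:Z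
  - \sum_(1 <= j < ((2 * t + 1) %/ 3).+1)
      ('C(2 * (t - j) + 1, j) * odd_dfact (t - j) * 2 ^ t * m ^ (t - j))%N%:Z
  + \sum_(2 <= k < t) (odd_dfact k * 2 ^ (2 * k) * m.+1 ^ k)%N%:Z
  - \sum_(2 <= k < t) \sum_(1 <= j < ((2 * k + 1) %/ 3).+1)
      ('C(2 * (k - j) + 1, j) * odd_dfact (k - j) * 2 ^ (2 * k)
       * m ^ (k - j))%N%:Z.

(* Main.v *)
From HB Require Import structures.
Require Import Defs.
From mathcomp Require Import all_boot all_order all_algebra.
From mathcomp Require Import freeg boolp zify ring.
Import Order.TTheory GRing.Theory Num.Theory.
Set Implicit Arguments.
Unset Strict Implicit.
Unset Printing Implicit Defensive.
Local Open Scope ring_scope.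

(** The upper bound comes from a spanning family.  Read with a doubled arrow,
    the second relation says that a diagram with a negative arrow equals minus
    the sum of the diagram in which that arrow has become positive and of a
    diagram with one more arrow; as diagrams with more than t arrows vanish,
    descending on the number of missing arrows shows that the positive diagrams
    span (class_span_positive).  Those with an isolated arrow of maximal label
    vanish by the first relation.  It remains to count.

    A positive diagram with k+1 arrows is obtained in exactly one way from one
    with k arrows: put a new endpoint in front of all others, and its partner in
    one of the 2k+1 gaps.  This lists (2k-1)!! 2^k (m+1)^k words
    (positive_words).  In such a list, consider the words whose arrows of
    maximal label are exactly j and are all isolated (blocked).  Looking at the
    first endpoint, their number F(k, j) satisfies
      F(k+1, j) >= 2 m (2k+1-j) F(k, j) + 2 F(k, j-1),
    because a new arrow of another label may end in every gap but the j ones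
    inside an isolated arrow, and a new arrow of maximal label may be isolated
    itself.  Hence F(n+j, j) >= C(2n+j, j) (2n-1)!! 2^(n+j) m^n
    (count_blocked), which is at least the corresponding term of Omega,
    with C(2n+1, j), when j > 0.  So the positive words with k arrows and
    without isolated arrow of maximal label are no more than the bracket of
    degree k (count_cutfree).  Degrees 0 and 1 contribute at most
    1 + 2m <= 4m, and in the middle degrees Omega even has the bracket times 2^k.

    For the lower bound, send an arrow of label i <= m to y_i if it is positive
    and to 1/(1+y_i) - 1 if it is negative, an arrow of label m+1 to 0, and a
    diagram to the product over its arrows, in Z[[y_1, ..., y_m]] modulo degree
    greater than t.  The second relation holds since
    u v + u + v = (1+u)(1+v) - 1, the third since the product only depends on
    the signs and labels of the arrows.  Each monomial of degree at most t is
    the image of a diagram made of isolated positive arrows, and there are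
    C(m+t, m) = (t+1)/m C(m+t, 1+t) of them (independent_isolated). *)

(** * Renaming the arrows of a Gauss word *)

Definition relabel m (f : arrow m -> arrow m) (w : seq (endpoint m)) :=
  [seq (f x.1, x.2) | x <- w].

(** Relabelling by such a map changes the word but not the diagram
    (diagram_of_relabel). *)
Definition renaming m (f : arrow m -> arrow m) (w : seq (endpoint m)) : Prop :=
  {in arrows w &, injective f} /\
  {in arrows w, forall a, sign (f a) = sign a /\ label (f a) = label a}.

Lemma arrowsP m (w : seq (endpoint m)) a :
  reflect (exists e, (a, e) \in w) (a \in arrows w).
Proof.
rewrite mem_undup; apply: (iffP mapP) => [[[b e] bw ->]|[e aw]].
  by exists e.
by exists (a, e).
Qed.

Lemma arrows_relabel m f (w : seq (endpoint m)) :
  {in arrows w &, injective f} -> arrows (relabel f w) = map f (arrows w).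
Proof.
move=> f_inj; rewrite /arrows -undup_map_in -?map_comp // => a b aw bw.
by apply: f_inj; rewrite mem_undup.
Qed.

Lemma index_map_in (T U : eqType) (f : T -> U) s x :
  {in s &, injective f} -> x \in s -> index (f x) (map f s) = index x s.
Proof.
elim: s => //= y s IHs f_inj; rewrite inE.
have [-> _|nxy /= xs] := eqVneq x y; first by rewrite !eqxx.
have ->: (f y == f x) = false.
  apply: contra_neqF nxy => /eqP eq_f.
  by apply/esym/f_inj; rewrite ?inE ?eqxx ?xs ?orbT.
rewrite IHs // => u v us vs.
by apply: f_inj; rewrite inE ?us ?vs orbT.
Qed.

Lemma normalize_relabel m f (w : seq (endpoint m)) :
  renaming f w -> normalize (relabel f w) = normalize w.
Proof.
case=> f_inj f_sl; rewrite /normalize -map_comp; apply/eq_in_map=> -[a e] xw.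
have aw := mem_arrows xw; have [fs fl] := f_sl _ aw.
by rewrite /= /rename arrows_relabel // index_map_in // fs fl.
Qed.

Lemma diagram_of_relabel m f (w : seq (endpoint m)) :
  renaming f w -> diagram_of (relabel f w) = diagram_of w.
Proof. by rewrite /diagram_of => /normalize_relabel ->. Qed.

Lemma renaming_rename m (w : seq (endpoint m)) : renaming (rename w) w.
Proof. by split=> // a b; apply: rename_inj. Qed.

Lemma arrows_filter m (w : seq (endpoint m)) (p : pred (arrow m)) :
  arrows [seq x <- w | p x.1] = [seq a <- arrows w | p a].
Proof. by rewrite /arrows filter_undup filter_map. Qed.

(** Removing an arrow from the canonical word of a diagram amounts to removing
    it from any word of the diagram, so the relations can be applied to words
    that are not canonical. *)
Lemma remove_normalize m (w : seq (endpoint m)) a :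
  a \in arrows w ->
  remove (normalize w) (rename w a) = diagram_of [seq x <- w | x.1 != a].
Proof.
move=> aw; rewrite /remove /normalize filter_map.
have ->: [seq x <- w | (preim (fun x => (rename w x.1, x.2))
              (fun x => x.1 != rename w a)) x] = [seq x <- w | x.1 != a].
  apply: eq_in_filter => x xw /=; congr (~~ _); apply/eqP/eqP => [|-> //].
  by apply: rename_inj => //; apply: mem_arrows.
have [rn_inj rn_sl] := renaming_rename w.
apply: (@diagram_of_relabel m (rename w)); split=> [b c|b].
  by rewrite (@arrows_filter m w (predC1 a)) !mem_filter
     => /andP[_ bw] /andP[_ cw]; apply: rn_inj.
by rewrite (@arrows_filter m w (predC1 a)) mem_filter => /andP[_ /rn_sl].
Qed.

Lemma next_to_map m (g : endpoint m -> endpoint m) w x y :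
  next_to w x y -> next_to (map g w) (g x) (g y).
Proof.
move=> /infixP[u [v ->]]; apply/infixP; exists (map g u), (map g v).
by rewrite !map_cat.
Qed.

Lemma adjacent_map m (g : endpoint m -> endpoint m) w x y :
  adjacent w x y -> adjacent (map g w) (g x) (g y).
Proof. by case/orP=> /(next_to_map g) h; rewrite /adjacent h ?orbT. Qed.

Lemma adjacent_mem m (w : seq (endpoint m)) x y :
  adjacent w x y -> (x \in w) && (y \in w).
Proof.
by case/orP=> /mem_infix h; rewrite !h // !inE eqxx ?orbT.
Qed.

Lemma perm_gauss m (w : seq (endpoint m)) :
  gauss w -> perm_eq w [seq (a, e) | a <- arrows w, e <- [:: true; false]].
Proof.
case/andP=> w_uniq /allP w_closed; apply: uniq_perm => //.
  by apply: allpairs_uniq; rewrite ?undup_uniq // => -[a e] [b f] _ _.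
case=> a e; apply/idP/allpairsP => [aw|[[b f] /= [/arrowsP[g bw] _ [-> ->]]]].
  by exists (a, e); rewrite /= (mem_arrows aw); case: e {aw}.
have := w_closed _ bw; move: bw; rewrite /=.
by case: g; case: f.
Qed.

Lemma size_gauss m (w : seq (endpoint m)) :
  gauss w -> size w = (size (arrows w)).*2.
Proof.
by move=> /perm_gauss/perm_size ->; rewrite size_allpairs /= muln2.
Qed.

(** * Relations between classes of Gauss words *)

Section Classes.
Variables t m : nat.
Implicit Types (w : seq (endpoint m)) (a b : arrow m).

Definition class w : X t m := \pi_(X t m)%qT << diagram_of w >>.

Lemma subgroup_gen (V : zmodType) (R : V -> Prop) v : R v -> v \in subgroup R.
Proof.
move=> Rv; apply/asboolP; exists [:: (1, v)] => [p|]; last by rewrite big_seq1.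
by rewrite inE => /eqP ->.
Qed.

Lemma pi_eq0 (x : {freeg (diagram m)}) :
  (\pi_(X t m)%qT x == 0) = (x \in subgroup (@relator t m)).
Proof. by rewrite -(raddf0 (\pi_(X t m)%qT)) -Quotient.idealrBE subr0. Qed.

Lemma pi_relator x : relator t x -> \pi_(X t m)%qT x = 0.
Proof. by move=> /subgroup_gen; rewrite -pi_eq0 => /eqP. Qed.

Lemma class_big w : gauss w -> (t.*2 < size w)%N -> class w = 0.
Proof.
move=> w_gauss lt_tw; apply/pi_relator/A_gt.
rewrite val_diagram_of // arrows_normalize size_map.
by rewrite -ltn_double -size_gauss.
Qed.

Lemma class_isolated w a :
  gauss w -> isolated w a -> label a = ord_max -> class w = 0.
Proof.
move=> w_gauss /(adjacent_map (fun x => (rename w x.1, x.2))) a_iso a_max.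
apply: pi_relator; apply: (@Q1 t m _ (rename w a)) => //.
by rewrite val_diagram_of.
Qed.

Lemma class_Q2 w a b :
  gauss w -> sign a != sign b -> label a = label b ->
  adjacent w (tl a) (tl b) -> adjacent w (hd a) (hd b) ->
  class w + class [seq x <- w | x.1 != a] + class [seq x <- w | x.1 != b] = 0.
Proof.
move=> w_gauss ab_s ab_l tl_ab hd_ab.
have /andP[/mem_arrows /= aw /mem_arrows /= bw] := adjacent_mem tl_ab.
rewrite /class -!raddfD /= -!remove_normalize // -!val_diagram_of //.
apply/pi_relator/Q2; rewrite /Q2_pair val_diagram_of //.
have r := adjacent_map (fun x => (rename w x.1, x.2)).
by apply/and4P; split; [| apply/eqP | exact: (r _ _ _ tl_ab)
  | exact: (r _ _ _ hd_ab)].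
Qed.

End Classes.

(** * Trading negative arrows for positive ones *)

Lemma ltn_count (T : eqType) (p q : pred T) s x :
  subpred p q -> x \in s -> q x -> ~~ p x -> (count p s < count q s)%N.
Proof.
move=> pq /splitPr[u v] qx /negPf px; rewrite !count_cat /= qx px add0n add1n.
by rewrite addnS ltnS leq_add // sub_count.
Qed.

(** Inserts the arrow b parallel to a, each endpoint of b right after the
    corresponding endpoint of a. *)
Definition double_arrow m (a b : arrow m) (w : seq (endpoint m)) :=
  flatten [seq if x.1 == a then [:: x; (b, x.2)] else [:: x] | x <- w].

Section Double.
Variables (m : nat) (a b : arrow m).
Implicit Types (w : seq (endpoint m)).

Lemma count_double_arrow (p : pred (endpoint m)) w :
  count p (double_arrow a b w) =
  (count p w + count (fun x => (x.1 == a) && p (b, x.2)) w)%N.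
Proof.
elim: w => //= x w IHw; rewrite count_cat IHw.
by case: eqP => _ /=; rewrite ?addn0 !addnA // [(_ + count p w)%N]addnAC.
Qed.

Lemma mem_double_arrow w x :
  (x \in double_arrow a b w) = (x \in w) || (x.1 == b) && ((a, x.2) \in w).
Proof.
case: x => c e; elim: w => [|[d f] w IHw]; first by rewrite andbF.
rewrite /double_arrow /= mem_cat -/(double_arrow a b w) IHw !inE /= !xpair_eqE.
have [->|nda] := eqVneq d a; rewrite !inE !xpair_eqE ?eqxx /=.
  by case: (c == a); case: (c == b); case: (e == f); case: (_ \in w);
     case: (_ \in w).
by rewrite orbA.
Qed.

Lemma adjacent_double_arrow w e : (a, e) \in w ->
  adjacent (double_arrow a b w) (a, e) (b, e).
Proof.
case/splitPr=> u v; apply/orP; left; apply/infixP.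
exists (double_arrow a b u), (double_arrow a b v).
by rewrite /double_arrow map_cat flatten_cat /= eqxx.
Qed.

Hypotheses (w : seq (endpoint m)) (w_gauss : gauss w).
Hypotheses (aw : a \in arrows w) (bw : b \notin arrows w).

Lemma mem_endpoint e : (a, e) \in w.
Proof.
have /arrowsP[f afw] := aw; case/andP: w_gauss => _ /allP/(_ _ afw) /=.
by case: e f afw => -[].
Qed.

Lemma notin_fresh e : (b, e) \notin w.
Proof. by apply: contra bw => /mem_arrows. Qed.

Lemma gauss_double_arrow : gauss (double_arrow a b w).
Proof.
case/andP: (w_gauss) => w_uniq /allP w_closed; apply/andP; split.
  apply: count_mem_uniq => -[c e].
  rewrite count_double_arrow mem_double_arrow /=.
  rewrite count_uniq_mem //; have [->|ncb] := eqVneq c b; last first.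
    rewrite (@eq_count _ _ pred0) ?count_pred0 ?addn0 ?orbF // => x /=.
    by rewrite xpair_eqE (eq_sym b) (negPf ncb) andbF.
  rewrite (negPf (notin_fresh e)) (@eq_count _ _ (pred1 (a, e))).
    by rewrite count_uniq_mem.
  by case=> d f /=; rewrite !xpair_eqE eqxx.
apply/allP=> -[c e] /=; rewrite !mem_double_arrow /= => /orP[/w_closed -> //|].
by case/andP=> -> /w_closed ->; rewrite orbT.
Qed.

Lemma filter_double_arrow_new : [seq x <- double_arrow a b w | x.1 != b] = w.
Proof.
have : all (fun x => x.1 != b) w.
  by apply/allP=> x /mem_arrows xw; apply: contraNneq bw => <-.
elim: (w) => //= x v IHv /andP[xb vb]; rewrite filter_cat IHv //.
by case: eqP => _ /=; rewrite xb // eqxx.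
Qed.

Lemma filter_double_arrow_old :
  [seq x <- double_arrow a b w | x.1 != a] =
  relabel (fun c => if c == a then b else c) w.
Proof.
have nba: b != a by apply: contraNneq bw => ->.
elim: (w) => //= -[c e] v IHv; rewrite filter_cat IHv /=.
by have [->|nca] := eqVneq c a; rewrite /= ?eqxx ?nba ?nca.
Qed.

Lemma ltn_size_double_arrow : (size w < size (double_arrow a b w))%N.
Proof.
rewrite -!(count_predT) count_double_arrow /= -ltn_subLR // subnn -has_count.
by apply/hasP; exists (a, true); rewrite ?mem_endpoint /= ?eqxx.
Qed.

End Double.

Definition fresh m (w : seq (endpoint m)) : nat :=
  (\max_(x <- w) name x.1).+1.

Lemma fresh_notin m (w : seq (endpoint m)) s l :
  (fresh w, s, l) \notin arrows w.
Proof.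
apply/negP=> /arrowsP[e /(@leq_bigmax_seq _ _ predT (fun x => name x.1))].
by move=> /(_ isT); rewrite ltnn.
Qed.

Section Positive.
Variables t m : nat.

Definition positive (w : seq (endpoint m)) := all (fun x => sign x.1) w.

(** By the second relation applied to a doubled negative arrow a, the class of
    w is minus the sum of the class of the doubled word, which is longer and has
    as many negative endpoints, and of the class of w with a made positive.
    Both have a smaller value of the number of negative endpoints plus the
    number of endpoints missing to exceed 2t, beyond which classes vanish. *)
Lemma class_span_positive (S : zmodClosed (X t m)) :
  (forall w, gauss w -> positive w -> class t w \in S) ->
  forall w, gauss w -> class t w \in S.
Proof.
move=> posS w; pose neg := count (fun x : endpoint m => ~~ sign x.1).
have [k] := ubnP (neg w + (t.*2.+1 - size w)); elim: k w => // k IHk w.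
rewrite ltnS => le_k w_gauss.
have [w_pos|] := boolP (positive w); first exact: posS.
rewrite -has_predC => /hasP[[a e] aew /= a_neg].
have [lt_tw|le_wt] := ltnP t.*2 (size w); first by rewrite class_big ?rpred0.
pose b : arrow m := (fresh w, true, label a).
have bw : b \notin arrows w := fresh_notin _ _ _.
have aw : a \in arrows w by apply/arrowsP; exists e.
have dw_gauss := gauss_double_arrow a w_gauss bw.
have ab : sign a != sign b by rewrite (negPf a_neg).
have /eqP := @class_Q2 t m _ a b dw_gauss ab erefl
  (adjacent_double_arrow b (mem_endpoint w_gauss aw _))
  (adjacent_double_arrow b (mem_endpoint w_gauss aw _)).
rewrite filter_double_arrow_old // filter_double_arrow_new // addr_eq0.
move=> /eqP eq_w.
(* First the doubled word, then the word where b replaces a. *)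
rewrite -[class t w]opprK -eq_w rpredN rpredD //.
  apply: IHk => //; apply: leq_trans le_k.
  rewrite /neg count_double_arrow -addnS leq_add //; last first.
    rewrite ltn_sub2l ?ltnS // ltn_size_double_arrow //.
  set c := count (fun x => _ && _) w; have -> : c = 0%N.
    by rewrite /c (@eq_count _ _ pred0) ?count_pred0 // => x; apply: andbF.
  by rewrite addn0.
rewrite -filter_double_arrow_old //; apply: IHk; last exact: gauss_remove.
rewrite filter_double_arrow_old // size_map; apply: leq_trans le_k.
rewrite ltn_add2r /neg count_map; apply: (@ltn_count _ _ _ _ (a, e)) => //.
  by move=> x /=; case: eqP => [->|].
by rewrite /= eqxx.
Qed.

End Positive.

(** * Listing the positive Gauss words *)

Definition insert (T : Type) p (x : T) s := take p s ++ x :: drop p s.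

(** Where the partner of the new first endpoint goes, whether that first
    endpoint is the tail, and the label of the new arrow. *)
Definition placement m k := ('I_k.*2.+1 * bool * 'I_m.+1)%type.

(** The name k is fresh when w uses the names below k. *)
Definition add_arrow m k (c : placement m k) w : seq (endpoint m) :=
  let: (p, e, l) := c in let a := (k, true, l) in
  (a, e) :: insert p (a, ~~ e) w.

Fixpoint positive_words m k : seq (seq (endpoint m)) :=
  if k is k'.+1
  then [seq add_arrow c w | w <- positive_words m k',
                            c <- enum {: placement m k'}]
  else [:: [::]].

Lemma perm_add_arrow m k p e (l : 'I_m.+1) w :
  perm_eq (add_arrow ((p, e, l) : placement m k) w)
    [:: ((k, true, l), e), ((k, true, l), ~~ e) & w].
Proof. by rewrite /= perm_cons /insert -cat1s perm_catCA /= cat_take_drop. Qed.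

Lemma odd_dfactS n : odd_dfact n.+1 = (odd_dfact n * n.*2.+1)%N.
Proof. exact: big_ord_recr. Qed.

Lemma size_positive_words m k :
  size (positive_words m k) = (odd_dfact k * 2 ^ k * m.+1 ^ k)%N.
Proof.
elim: k => [|k IHk]; first by rewrite /odd_dfact big_ord0.
rewrite size_allpairs IHk -cardE !card_prod !card_ord card_bool.
by rewrite odd_dfactS !expnS; lia.
Qed.

Definition wellformed m k (w : seq (endpoint m)) :=
  [&& gauss w, size w == k.*2 & all (fun x => name x.1 < k)%N w].

Lemma wellformed_fresh_arrow m k (w : seq (endpoint m)) s l :
  wellformed k w -> ((k, s, l) : arrow m) \notin arrows w.
Proof.
case/and3P=> _ _ /allP w_lt; apply/negP=> /arrowsP[e /w_lt].
by rewrite ltnn.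
Qed.

Lemma gauss_cons2 m (w : seq (endpoint m)) a e :
  gauss [:: (a, e), (a, ~~ e) & w] = (a \notin arrows w) && gauss w.
Proof.
apply/idP/andP => [|[aw /andP[w_uniq /allP w_closed]]].
  case/andP; rewrite /= !inE !negb_or => /and3P[/andP[_ ae] ane w_uniq].
  move=> /and3P[_ _ /allP w_closed].
  have aw : a \notin arrows w.
    apply/arrowsP => -[f af]; move: ae ane.
    by case: e f af {w_closed} => -[] => ->.
  split=> //; apply/andP; split=> //; apply/allP=> x xw.
  have := w_closed x xw; rewrite !inE.
  have nxa f : (x.1, ~~ x.2) == (a, f) = false.
    by apply: contraNF aw => /eqP[<- _]; apply: mem_arrows.
  by rewrite !nxa.
have notin f : (a, f) \notin w by apply: contra aw => /mem_arrows.
rewrite /gauss /= !inE !xpair_eqE !eqxx /= negb_or !notin w_uniq /= !negbK.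
rewrite eqxx orbT; case: e => //=; apply/allP=> x /w_closed xw;
  by rewrite !inE xw !orbT.
Qed.

Lemma wellformed_positive_words m k :
  {in positive_words m k, forall w, wellformed k w}.
Proof.
elim: k => [|k IHk] w; first by rewrite inE => /eqP ->.
move=> /allpairsP[[v [[p e] l]] [/= /IHk v_wf _ ->]].
have perm_w := perm_add_arrow p e l v; rewrite /wellformed.
have v_fresh := wellformed_fresh_arrow true l v_wf.
have := v_wf; case/and3P=> v_gauss /eqP sz_v /allP v_lt.
have w_gauss : gauss [:: ((k, true, l), e), ((k, true, l), ~~ e) & v].
  by rewrite gauss_cons2 v_fresh.
rewrite (perm_size perm_w) (perm_all _ perm_w) (gauss_perm perm_w w_gauss).
rewrite /= sz_v eqxx /name /= ltnSn /=; apply/allP=> x /v_lt.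
exact: ltnW.
Qed.

(** The arrow owning the first endpoint of v is taken away; what is left is
    renamed to a listed word by induction, and the name k is free for the
    arrow to be put back. *)
Lemma positive_words_complete m k (v : seq (endpoint m)) :
  gauss v -> positive v -> size v = k.*2 ->
  exists2 f, renaming f v & relabel f v \in positive_words m k.
Proof.
elim: k v => [|k IHk] [|[a e] v] //= v_gauss v_pos.
  by exists id; rewrite ?inE //; split.
case=> sz_v; have aev : (a, ~~ e) \in v.
  case/andP: v_gauss => _ /andP[]; rewrite inE xpair_eqE eqxx /=.
  by case: (e).
case/splitPr: aev sz_v v_gauss v_pos => v1 v2 sz_v v_gauss.
rewrite /positive /= all_cat /= => /and4P[a_pos v1_pos _ v2_pos].
have : perm_eq ((a, e) :: v1 ++ (a, ~~ e) :: v2)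
               [:: (a, e), (a, ~~ e) & v1 ++ v2].
  by rewrite perm_cons -cat1s perm_catCA.
rewrite perm_sym => /gauss_perm/(_ v_gauss); rewrite gauss_cons2.
case/andP=> av u_gauss.
have [||f [f_inj f_sl] f_gen] := IHk (v1 ++ v2) u_gauss.
- by rewrite /positive all_cat v1_pos.
- by move: sz_v; rewrite !size_cat /= addnS => -[].
have f_fresh :=
  wellformed_fresh_arrow true (label a) (wellformed_positive_words f_gen).
have fK : arrows (relabel f (v1 ++ v2)) = map f (arrows (v1 ++ v2)).
  exact: arrows_relabel.
pose b : arrow m := (k, true, label a).
pose g c := if c == a then b else f c.
have arrE c : c \in arrows ((a, e) :: v1 ++ (a, ~~ e) :: v2) ->
    c = a \/ c \in arrows (v1 ++ v2).
  have [-> _|nca] := eqVneq c a; first by left.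
  case/arrowsP=> h; rewrite inE mem_cat inE !xpair_eqE (negPf nca) /= => ch.
  by right; apply/arrowsP; exists h; rewrite mem_cat.
have gE c : c \in arrows (v1 ++ v2) -> g c = f c.
  by rewrite /g; case: eqP => // ->; rewrite (negPf av).
have ga : g a = b by rewrite /g eqxx.
have gNb c : c \in arrows (v1 ++ v2) -> g c <> g a.
  move=> cv; rewrite gE // ga => eq_b.
  by case/negP: f_fresh; rewrite -/b -eq_b fK map_f.
exists g.
  split=> [c d /arrE[->|cv] /arrE[->|dv] //|c /arrE[->|cv]].
  - by move/esym/(gNb _ dv).
  - by move/(gNb _ cv).
  - by rewrite !gE //; apply: f_inj.
  - by rewrite ga; split=> //; rewrite a_pos.
  - by rewrite gE //; apply: f_sl.
have lt_p : (size v1 < k.*2.+1)%N.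
  by move: sz_v; rewrite size_cat /= addnS => -[<-]; rewrite ltnS leq_addr.
apply/allpairsP.
exists (relabel f (v1 ++ v2), (Ordinal lt_p, e, label a)).
split; rewrite ?mem_enum //= /insert /relabel !map_cat /=.
rewrite -/(relabel g v1) take_size_cat ?size_map // drop_size_cat ?size_map //.
have relE (s : seq (endpoint m)) : {subset s <= v1 ++ v2} ->
    relabel g s = relabel f s.
  by move=> sv; apply/eq_in_map=> x /sv/mem_arrows/gE /= ->.
rewrite -/b ga -/(relabel g v2) !relE // => x xv;
  by rewrite mem_cat xv ?orbT.
Qed.

(** * Cuts and the spanning family *)

(** For consecutive x and y: they are the two ends of an isolated arrow of
    maximal label, which the first relation kills. *)
Definition cut m (x y : endpoint m) :=
  (x.1 == y.1) && (label x.1 == ord_max).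

(** The cuts of x :: w.  A fresh x makes it the number of cuts of w, which
    turns the cuts of a word into the entries of a list of booleans having one
    entry for each gap of w but the last one. *)
Definition cuts_from m (x : endpoint m) w := count id (pairmap (@cut m) x w).

Definition cuts m (w : seq (endpoint m)) :=
  if w is x :: v then cuts_from x v else 0%N.

Lemma cuts_infix m (w : seq (endpoint m)) : (0 < cuts w)%N ->
  exists x y, cut x y /\ next_to w x y.
Proof.
case: w => // x w; elim: w x => //= y w IHw x; rewrite /cuts_from /=.
have [xy _|_ /IHw[u [v [uv /infixP[w1 [w2 ->]]]]]] := boolP (cut x y).
  exists x, y; split=> //; apply/infixP; exists [::], w; by [].
by exists u, v; split=> //; apply/infixP; exists (x :: w1), w2.
Qed.

Lemma class_cuts t m (w : seq (endpoint m)) :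
  gauss w -> (0 < cuts w)%N -> class t w = 0.
Proof.
move=> w_gauss /cuts_infix[[a e] [[b f] [/andP[/= /eqP<- /eqP a_max] ab]]].
apply: (class_isolated t w_gauss _ a_max).
have : uniq [:: (a, e); (a, f)].
  by case/infixP: ab w_gauss => u [v ->] /andP[]; rewrite !cat_uniq =>
     /and3P[_ _ /and3P[]].
rewrite /isolated /adjacent /= inE xpair_eqE eqxx andbT.
by case: e f ab => -[] // -> _; rewrite ?orbT.
Qed.

Definition spanning_words t m : seq (seq (endpoint m)) :=
  flatten [seq [seq w <- positive_words m k | cuts w == 0%N]
          | k <- iota 0 t.+1].

(** A positive word is renamed to a listed one, whose class is zero if it has a
    cut; an arbitrary element is a combination of classes of Gauss words. *)
Lemma class_span_cutfree t m (S : zmodClosed (X t m)) :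
  {in spanning_words t m, forall w, class t w \in S} -> forall x, x \in S.
Proof.
move=> spanS.
have wordS : forall w, gauss w -> class t w \in S.
  apply: class_span_positive => w w_gauss w_pos.
  have [lt_tw|le_wt] := ltnP t.*2 (size w).
    by rewrite class_big ?rpred0.
  have sz_w := size_gauss w_gauss; set k := size (arrows w) in sz_w.
  have [f f_ren f_gen] := positive_words_complete w_gauss w_pos sz_w.
  rewrite /class -(diagram_of_relabel f_ren) -/(class t _).
  have [cuts0|cuts_gt0] := posnP (cuts (relabel f w)); last first.
    rewrite class_cuts ?rpred0 //.
    by case/and3P: (wellformed_positive_words f_gen).
  apply: spanS; apply/flattenP.
  exists [seq v <- positive_words m k | cuts v == 0%N]; last first.
    by rewrite mem_filter cuts0.
  apply/mapP; exists k => //.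
  by rewrite mem_iota leq0n add0n ltnS -leq_double -sz_w.
move=> x; rewrite -[x]reprK -[repr x]freeg_sumE raddf_sum rpred_sum //= => D _.
have -> : << coeff D (repr x) *g D >> = << D >> *~ coeff D (repr x).
  by rewrite freegU_mulz intz.
rewrite raddfMz rpredMz // -[D in << D >>]diagram_ofK wordS //.
by case: D => w /= /andP[].
Qed.

Lemma cuts_fresh m (w : seq (endpoint m)) x :
  x.1 \notin arrows w -> cuts w = cuts_from x w.
Proof.
case: w => // y w xw; rewrite /cuts_from /= /cut.
by case: eqP => // xy; rewrite xy (mem_arrows (mem_head _ _)) in xw.
Qed.

(** * Counting the words with a prescribed set of cuts *)

Definition max_ends m (w : seq (endpoint m)) :=
  count (fun x => label x.1 == ord_max) w.

(** Each cut accounts for two ends of maximal label, so all the arrows of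
    maximal label are isolated and there are j of them. *)
Definition blocked m j (w : seq (endpoint m)) :=
  (cuts w == j) && (max_ends w == j.*2).

(** The gap p of w lies between the endpoints p - 1 and p; gap 0 precedes w and
    the last one follows it.  The default value says that the last gap is not
    cut. *)
Definition cut_at m (x : endpoint m) w p := nth false (pairmap (@cut m) x w) p.

(** An endpoint inserted in a gap which is not cut destroys no cut.  It creates
    one precisely when it lands next to its own partner, in gap 0, and the label
    is maximal. *)
Lemma cuts_insert m (w : seq (endpoint m)) p a e :
  a \notin arrows w -> (p <= size w)%N -> ~~ cut_at (a, e) w p ->
  cuts ((a, e) :: insert p (a, ~~ e) w) =
  ((p == 0%N) && (label a == ord_max) + cuts w)%N.
Proof.
move=> aw le_p.
rewrite (@cuts_fresh _ w (a, e)) //= /cuts_from /insert /cut_at.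
rewrite -{1 4}(cat_take_drop p w) !pairmap_cat /= !count_cat /=.
rewrite addnCA nth_cat size_pairmap size_takel // ltnn subnn => p_ok.
congr (_ + (_ + _))%N.
  case: p le_p {p_ok} => [|p le_p]; first by rewrite take0 /cut /= eqxx.
  have : last (a, e) (take p.+1 w) \in w.
    case: (w) le_p => //= x v _; rewrite inE; have := mem_last x (take p v).
    by rewrite inE => /predU1P[->|/mem_take ->]; rewrite ?eqxx ?orbT.
  by rewrite /cut; case: eqP => //= eq_a /mem_arrows; rewrite eq_a (negPf aw).
case def_d: (drop p w) p_ok => [|z d] //= /negPf ->.
have zw : z \in w by rewrite (mem_drop (n0 := p)) // def_d mem_head.
rewrite {1}/cut /=; case: eqP => // az.
by case/negP: aw; rewrite az (mem_arrows zw).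
Qed.

Lemma card_uncut m (w : seq (endpoint m)) x n : size w = n ->
  #|[pred p : 'I_n.+1 | ~~ cut_at x w p]| = (n.+1 - cuts_from x w)%N.
Proof.
move=> <-.
have le_c : (cuts_from x w <= size w)%N.
  by rewrite -(size_pairmap (@cut m) x w) count_size.
rewrite subSn // -sum1_card big_mkcond big_ord_recr /=.
rewrite inE /cut_at nth_default ?size_pairmap //= addn1; congr _.+1.
rewrite /cuts_from -[X in (X - _)%N](size_pairmap (@cut m) x w).
rewrite -(count_predC id (pairmap _ x w)) addKn -sum1_count.
rewrite [RHS](big_nth false) size_pairmap big_mkord [RHS]big_mkcond.
by apply: eq_bigr => p _; rewrite inE.
Qed.

Lemma count_sum (T : Type) (p : pred T) s : count p s = (\sum_(x <- s) p x)%N.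
Proof.
by rewrite -sum1_count big_mkcond; apply: eq_bigr => x _; case: (p x).
Qed.

Lemma count_enumT (T : finType) (p : pred T) : count p (enum T) = #|p|.
Proof. by rewrite -sum1_count big_enum_cond sum1_card. Qed.

Arguments add_arrow : simpl never.

Section AddArrow.
Variables (m k : nat) (w : seq (endpoint m)).
Hypothesis w_wf : wellformed k w.

Lemma max_ends_add p e (l : 'I_m.+1) :
  max_ends (add_arrow ((p, e, l) : placement m k) w) =
  ((l == ord_max).*2 + max_ends w)%N.
Proof.
rewrite /max_ends (permP (perm_add_arrow p e l w)) /= addnA.
by congr addn; rewrite addnn.
Qed.

Lemma cuts_add (p : 'I_k.*2.+1) e (l : 'I_m.+1) :
  ~~ cut_at ((k, true, l), e) w p ->
  cuts (add_arrow (p, e, l) w) =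
  (((p : nat) == 0%N) && (l == ord_max) + cuts w)%N.
Proof.
case/and3P: (w_wf) => _ /eqP sz_w _.
apply: cuts_insert; first exact: wellformed_fresh_arrow.
by rewrite sz_w -ltnS ltn_ord.
Qed.

Lemma cut_at_fresh e (l l' : 'I_m.+1) e' :
  cut_at ((k, true, l), e) w =1 cut_at ((k, true, l'), e') w.
Proof.
have := wellformed_fresh_arrow true l w_wf.
have := wellformed_fresh_arrow true l' w_wf.
case: (w) => // x v xl' xl [|p] //; rewrite /cut_at /= /cut /=.
have neq (a : arrow m) : a \notin arrows (x :: v) -> (a == x.1) = false.
  by apply: contraNF => /eqP ->; apply/mem_arrows/mem_head.
by rewrite !neq.
Qed.

(** The gaps which are not cut are k.*2.+1 - j in number, and there are m other
    labels and two directions. *)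
Lemma count_add_nonmax j : blocked j w ->
  (2 * m * (k.*2.+1 - j) <=
   count (fun c => blocked j (add_arrow c w)) (enum {: placement m k}))%N.
Proof.
case/andP=> /eqP w_cuts /eqP w_max; case/and3P: (w_wf) => _ /eqP sz_w _.
pose x0 : endpoint m := ((k, true, ord_max), true).
have w_x0 : cuts_from x0 w = j.
  by rewrite -w_cuts (cuts_fresh (x := x0)) ?wellformed_fresh_arrow.
rewrite count_enumT.
pose A := [pred p : 'I_k.*2.+1 | ~~ cut_at x0 w p].
pose B := [predX [predX A & @predT bool] & predC1 (@ord_max m)].
have -> : (2 * m * (k.*2.+1 - j))%N = #|B|.
  rewrite !cardX card_bool (card_uncut x0 sz_w) w_x0.
  by rewrite cardC1 card_ord /=; lia.
apply/subset_leq_card/subsetP => -[[p e] l] /=; rewrite !inE /= andbT.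
case/andP=> p_ok /negPf nl; rewrite unfold_in.
have {}nl : (l == ord_max :> 'I_m.+1) = false := nl.
rewrite /blocked max_ends_add cuts_add ?nl ?andbF.
  by rewrite w_cuts w_max !eqxx.
by rewrite (cut_at_fresh _ _ ord_max true).
Qed.

(** Gap 0, the maximal label, and two directions. *)
Lemma count_add_max j : blocked j w ->
  (2 <= count (fun c => blocked j.+1 (add_arrow c w))
              (enum {: placement m k}))%N.
Proof.
case/andP=> /eqP w_cuts /eqP w_max.
rewrite count_enumT.
pose B := [predX [predX pred1 (@ord0 k.*2) & @predT bool] & pred1 (@ord_max m)].
have -> : 2%N = #|B| by rewrite !cardX card_bool !card1.
apply/subset_leq_card/subsetP => -[[p e] l] /=; rewrite !inE /= andbT.
case/andP=> /eqP-> /eqP->; rewrite unfold_in /blocked max_ends_add cuts_add.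
  by rewrite w_cuts w_max /= doubleS !eqxx.
rewrite /cut_at.
case: (w) (wellformed_fresh_arrow true ord_max w_wf) => //= x v xv.
rewrite /cut /=; case: eqP => // eq_x.
by rewrite eq_x mem_arrows ?mem_head in xv.
Qed.

End AddArrow.

(** The two lower bounds concern different words w, since a word is blocked
    for a single j. *)
Lemma count_blocked_rec m k j :
  ((2 * m * (k.*2.+1 - j)) * count (blocked j) (positive_words m k)
   + (if j is i.+1 then 2 * count (blocked i) (positive_words m k) else 0)
   <= count (blocked j) (positive_words m k.+1))%N.
Proof.
rewrite /= count_flatten -map_comp sumnE big_map.
have -> : (if j is i.+1 then 2 * count (blocked i) (positive_words m k)
           else 0)%N =
    (\sum_(w <- positive_words m k)
        (if j is i.+1 then 2 * blocked i w else 0))%N.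
  case: j => [|j]; first by rewrite big1.
  by rewrite count_sum big_distrr.
rewrite count_sum big_distrr /= -big_split /= big_seq [leqRHS]big_seq.
apply: leq_sum => w /wellformed_positive_words w_wf; rewrite count_map.
have [w_j|w_nj] := boolP (blocked j w).
  rewrite muln1 (_ : (if j is _.+1 then _ else _) = 0)%N ?addn0.
    exact: count_add_nonmax.
  case: j w_j => // j /andP[/eqP w_cuts _].
  by rewrite /blocked w_cuts eqn_leq ltnn.
rewrite muln0 add0n; case: j w_nj => // j _.
by case: (boolP (blocked j w)) => // /(count_add_max w_wf).
Qed.

(** The bound satisfies the recurrence of count_blocked_rec with equality.  It
    counts the multisets of j gaps among 2n+1, in which isolated arrows are
    inserted, times the choices for the n other arrows. *)
Lemma count_blocked m n j :
  ('C(2 * n + j, j) * odd_dfact n * 2 ^ (n + j) * m ^ n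
   <= count (blocked j) (positive_words m (n + j)))%N.
Proof.
have [k def_k] : {k | k = (n + j)%N} by exists (n + j)%N.
rewrite -def_k; elim: k n j def_k => [|k IHk] n j def_k.
  have [-> ->] : n = 0%N /\ j = 0%N by lia.
  by rewrite /odd_dfact big_ord0.
apply: leq_trans (count_blocked_rec _ _ _).
case: n j def_k => [|n] [|j] def_k //.
- have {}def_k : k = j by lia.
  have := IHk 0%N j; rewrite add0n => /(_ def_k).
  rewrite !muln0 !add0n !binn !expn0 !muln1 expnS /odd_dfact big_ord0; lia.
- have {}def_k : k = n by lia.
  have := IHk n 0%N; rewrite addn0 => /(_ def_k).
  rewrite !addn0 !bin0 subn0 def_k !expnS odd_dfactS !mul1n.
  move=> /(leq_mul (leqnn (2 * m * n.*2.+1)%N)); apply: leq_trans.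
  by apply: eq_leq; ring.
have def_k1 : k = (n + j.+1)%N by lia.
have def_k2 : k = (n.+1 + j)%N by lia.
have := leq_add (leq_mul (leqnn (2 * m * (k.*2.+1 - j.+1))%N) (IHk _ _ def_k1))
                (leq_mul (leqnn 2) (IHk _ _ def_k2)).
apply: leq_trans; apply: eq_leq.
have def_N : (2 * n.+1 + j.+1 = (2 * n + j.+1).+2)%N by lia.
have -> : (2 * n.+1 + j = (2 * n + j.+1).+1)%N by lia.
have -> : (k.*2.+1 - j.+1 = (2 * n + j.+1).+1)%N by lia.
have := mul_bin_down (2 * n + j.+1).+1 j.+1.
rewrite (_ : (_.+1 - j.+1 = n.*2.+1)%N) /=; last by lia.
move: (binS (2 * n + j.+1).+1 j); rewrite def_N !expnS odd_dfactS.
move: 'C(_, _) 'C(_, _) 'C(_, _) 'C(_, _) => c c1 c2 c3 -> bin_N.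
transitivity (2 * m * (n.*2.+1 * c2) * (odd_dfact n * 2 ^ k * m ^ n)
              + 2 * (c1 * (odd_dfact n * n.*2.+1) * 2 ^ k * (m * m ^ n)))%N.
  by ring.
by rewrite -bin_N; ring.
Qed.

(** A word is blocked for at most one j, and has a cut if that j is positive.
    The binomial coefficient of the statement counts the sets of j gaps among
    2n+1, with n = k - j, hence is at most the one of count_blocked. *)
Lemma count_cutfree m k :
  (count (fun w => cuts w == 0%N) (positive_words m k)
   + \sum_(1 <= j < ((2 * k + 1) %/ 3).+1)
       'C(2 * (k - j) + 1, j) * odd_dfact (k - j) * 2 ^ k * m ^ (k - j)
   <= odd_dfact k * 2 ^ k * m.+1 ^ k)%N.
Proof.
rewrite -size_positive_words.
rewrite -(count_predC (fun w => cuts w == 0%N) (positive_words m k)) leq_add2l.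
pose J := ((2 * k + 1) %/ 3).+1.
apply: (@leq_trans (\sum_(1 <= j < J) count (blocked j) (positive_words m k))).
  rewrite big_nat [leqRHS]big_nat; apply: leq_sum => j /andP[j_gt0 lt_j].
  have le_jk : (j <= k)%N by lia.
  have := count_blocked m (k - j) j; rewrite subnK //; apply: leq_trans.
  by rewrite !leq_mul2r leq_bin2l ?orbT // leq_add2l.
rewrite (eq_bigr _ (fun j _ => count_sum (blocked j) _)) exchange_big /=.
rewrite count_sum; apply: leq_sum => w _ /=.
case: posnP => [w0|_] /=.
  rewrite big_nat big1 // => j /andP[j_gt0 _].
  by rewrite /blocked w0 eq_sym -[_ == _]negbK -lt0n j_gt0.
apply: (@leq_trans (\sum_(1 <= j < J | j == cuts w) 1)%N).
  rewrite [leqRHS]big_mkcond; apply: leq_sum => j _.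
  by rewrite /blocked eq_sym; case: eqP => //= _; case: eqP.
by rewrite sum1_count (count_uniq_mem (cuts w)) ?iota_uniq ?leq_b1.
Qed.

(** * Independence over the integers *)

(** A left kernel vector over the rationals, with its denominators cleared. *)
Lemma int_left_kernel n N (A : 'M[int]_(n, N)) : (N < n)%N ->
  exists2 c : 'rV[int]_n, c != 0 & c *m A = 0.
Proof.
move=> lt_Nn; pose Aq := map_mx (intr : int -> rat) A.
have /rowV0Pn[u /sub_kermxP uA u_neq0] : kermx Aq != 0.
  by rewrite kermx_eq0 /row_free neq_ltn (leq_ltn_trans (rank_leq_col Aq)).
(* d clears the denominators of u; its product with u is the vector c. *)
pose d := \prod_j denq (u 0 j).
have d_neq0 : d != 0 by apply/prodf_neq0 => j _; rewrite denq_neq0.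
pose c := \row_j (numq (u 0 j) * \prod_(i | i != j) denq (u 0 i)).
have cE : map_mx (intr : int -> rat) c = d%:~R *: u.
  apply/rowP=> j; rewrite !mxE /d [in RHS](bigD1 j) //= !intrM numqE.
  by ring.
have map_inj : injective (map_mx (intr : int -> rat) : 'M_(_, _) -> 'M_(_, _)).
  move=> p q x y /matrixP eq_xy; apply/matrixP=> i j.
  by have := eq_xy i j; rewrite !mxE => /intr_inj.
exists c.
  rewrite -(inj_eq (@map_inj _ _)) map_mx0 cE scaler_eq0 negb_or u_neq0 andbT.
  by rewrite intr_eq0.
by apply: (@map_inj _ _); rewrite map_mxM cE -scalemxAl uA scaler0 map_mx0.
Qed.

(** Otherwise the integer matrix of coordinates has more rows than columns, and
    a relation between its rows is a relation between the v i. *)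
Lemma independent_leq_span (V : zmodType) (s : seq V) n (v : 'I_n -> V) :
  (forall x, x \in subgroup (fun y => y \in s)) -> independent v ->
  (n <= size s)%N.
Proof.
move=> s_span v_ind; rewrite leqNgt; apply/negP=> lt_sn.
have coordP i : exists a : 'rV[int]_(size s),
    v i = \sum_(j < size s) s`_j *~ a 0 j.
  have /asboolP[r rs ->] := s_span (v i).
  elim: r rs => [|[a y] r IHr] rs.
    by exists 0; rewrite big_nil big1 // => j _; rewrite mxE mulr0z.
  have [b r_b] : exists a : 'rV[int]_(size s),
      \sum_(p <- r) p.2 *~ p.1 = \sum_(j < size s) s`_j *~ a 0 j.
    by apply: IHr => p pr; apply: rs; rewrite inE pr orbT.
  have ys : y \in s := rs (a, y) (mem_head _ _).
  have lt_y : (index y s < size s)%N by rewrite index_mem.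
  exists (b + a *: delta_mx 0 (Ordinal lt_y)); rewrite big_cons r_b /= addrC.
  rewrite [RHS](eq_bigr (fun j : 'I_(size s) => s`_j *~ b 0 j
    + (if j == Ordinal lt_y then s`_j *~ a else 0))) => [|j _].
    by rewrite big_split -big_mkcond big_pred1_eq /= nth_index.
  rewrite !mxE mulrzDr eqxx /=; case: (j == _); first by rewrite mulr1.
  by rewrite mulr0 mulr0z.
have [a v_a] := boolp.choice coordP.
have [c c_neq0 /rowP cA] := int_left_kernel (\matrix_(i, j) a i 0 j) lt_sn.
case/eqP: c_neq0; apply/rowP=> i; rewrite mxE.
apply: (v_ind (fun i => c 0 i)).
transitivity (\sum_(i < n) \sum_(j < size s) s`_j *~ (c 0 i * a i 0 j)).
  apply: eq_bigr => k _; rewrite v_a mulrz_suml; apply: eq_bigr => j _.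
  by rewrite mulrC mulrzA.
rewrite exchange_big big1 //= => j _; rewrite -mulrz_sumr.
have := cA j; rewrite !mxE.
rewrite (eq_bigr (fun i : 'I_n => c 0 i * a i 0 j)) => [->|k _].
  by rewrite mulr0z.
by rewrite mxE.
Qed.

(** * Independent elements *)

Section Functional.
Variables (t m : nat) (alpha : 'I_m.+1 -> nat).
Implicit Types (s : seq (arrow m)) (w : seq (endpoint m)).

(** With X in front, this is the polynomial 1/(1+X) - 1 truncated at degree t
    when the sign is negative.  Keeping the factor X apart shows that a product
    of n weights is divisible by the n-th power of X. *)
Definition weight_factor (b : bool) : {poly int} :=
  if b then 1 else - \sum_(k < t) (- 'X) ^+ k.

Definition weight (b : bool) : {poly int} := 'X * weight_factor b.

Definition series (i : 'I_m.+1) s : {poly int} :=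
  \prod_(a <- s | label a == i) weight (sign a).

(** The coefficient of the monomial with exponents alpha in the product of the
    weights of the arrows of s, where the variable is that of the label.  An
    exponent 0 for the maximal label amounts to mapping its arrows to 0. *)
Definition mono_coef s : int := \prod_i (series i s)`_(alpha i).

(** (1 + X) times the truncation of 1/(1 + X) differs from 1 by a term of
    degree t + 1. *)
Lemma weight_Q2 b : exists e : bool,
  weight b * weight (~~ b) + weight b + weight (~~ b) = (-1) ^+ e * 'X ^+ t.+1.
Proof.
suff [e eE] : exists e : bool, weight true * weight false + weight true
    + weight false = (-1) ^+ e * 'X ^+ t.+1.
  by exists e; rewrite -eE; case: b => //=; ring.
exists (odd t); rewrite signr_odd.
have := subrX1 (- 'X : {poly int}) t; rewrite [(- 'X) ^+ t]exprNn exprS.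
rewrite /weight /weight_factor; set S := \sum_(i < t) _ => eq_S.
transitivity ('X * (1 + (- 'X - 1) * S)); first by ring.
by rewrite -eq_S; ring.
Qed.

Lemma series_perm i s s' : perm_eq s s' -> series i s = series i s'.
Proof. exact: perm_big. Qed.

Lemma mono_coef_perm s s' : perm_eq s s' -> mono_coef s = mono_coef s'.
Proof. by move=> ss'; apply: eq_bigr => i _; rewrite (series_perm i ss'). Qed.

Lemma mono_coef_map f s :
  {in s, forall a, sign (f a) = sign a /\ label (f a) = label a} ->
  mono_coef (map f s) = mono_coef s.
Proof.
move=> f_sl; apply: eq_bigr => i _.
suff -> : series i (map f s) = series i s by [].
rewrite /series big_map big_seq_cond [RHS]big_seq_cond; apply: eq_big => a.
  by case: (boolP (a \in s)) => //= /f_sl[_ ->].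
by case/andP=> /f_sl[-> _].
Qed.

(** The series of the label i is then divisible by too high a power of X. *)
Lemma mono_coef_eq0 s i :
  (alpha i < count (fun a => label a == i) s)%N -> mono_coef s = 0.
Proof.
move=> lt_i; rewrite /mono_coef (bigD1 i) //= /series /weight big_split /=.
by rewrite big_const_seq iter_mulr_1 coefXnM lt_i mul0r.
Qed.

Lemma mono_coef_big s :
  (\sum_i alpha i <= t)%N -> (t < size s)%N -> mono_coef s = 0.
Proof.
move=> le_t lt_t.
have sz_s : size s = (\sum_i count (fun a => label a == i) s)%N.
  under eq_bigr do rewrite count_sum.
  rewrite exchange_big /= -sum1_size; apply: eq_bigr => a _.
  rewrite (bigD1 (label a)) //= eqxx big1 // => i /negPf.
  by rewrite eq_sym => ->.
have [i lt_i|all_le] :=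
  pickP (fun i => alpha i < count (fun a => label a == i) s)%N.
  exact: mono_coef_eq0 lt_i.
have : (size s <= t)%N.
  apply: leq_trans le_t; rewrite sz_s; apply: leq_sum => i _.
  by rewrite leqNgt all_le.
by rewrite leqNgt lt_t.
Qed.

(** Only the series of the common label differs between the three terms; their
    sum carries the factor computed in weight_Q2, of degree above alpha. *)
Lemma mono_coef_Q2 s a b : (forall i, alpha i <= t)%N ->
  sign a != sign b -> label a = label b ->
  mono_coef [:: a, b & s] + mono_coef (b :: s) + mono_coef (a :: s) = 0.
Proof.
move=> le_t ab_s ab_l; pose l := label a.
pose P := \prod_(i | i != l) (series i s)`_(alpha i).
have coefE u : all (fun c => label c == l) u ->
    mono_coef (u ++ s) =
    ((\prod_(c <- u) weight (sign c)) * series l s)`_(alpha l) * P.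
  move=> /allP u_l; rewrite /mono_coef (bigD1 l) //=; congr (_`__ * _).
    rewrite /series big_cat /=.
    have -> // : \prod_(c <- u | label c == l) weight (sign c) =
                 \prod_(c <- u) weight (sign c).
    rewrite big_seq_cond [RHS]big_seq; apply: eq_bigl => c.
    by case: (boolP (c \in u)) => //= /u_l.
  apply: eq_bigr => i /negPf nil; congr (_`__); rewrite /series big_cat /=.
  rewrite big_seq_cond big_pred0 ?mul1r // => c.
  by case: (boolP (c \in u)) => //= /u_l /eqP ->; rewrite eq_sym.
have := coefE [:: a; b]; have := coefE [:: b]; have := coefE [:: a].
rewrite !big_cons big_nil !mulr1 /= -ab_l !eqxx => -> // -> // -> //.
rewrite -!mulrDl -!coefD -!mulrDl.
have -> : sign b = ~~ sign a by case: (sign a) (sign b) ab_s => -[].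
have [e] := weight_Q2 (sign a); rewrite addrAC => ->.
rewrite -mulrA -mulrCA coefXnM ltnS le_t mul0r //.
Qed.

End Functional.

Lemma perm_Q3_word m (D : diagram m) (a b c : arrow m) :
  Q3_triple D a b c -> perm_eq (Q3_word D a b c) (val D).
Proof.
have D_uniq : uniq (val D) by case: D => w /= /andP[/andP[]].
case/and5P=> _ _ _ /mem_infix ab /and3P[/mem_infix ac /mem_infix bc _].
have perm_D x y w : perm_eq w (val D) -> {subset [:: x; y] <= val D} ->
    perm_eq (swap x y w) (val D).
  move=> wD xyD; apply: perm_trans (wD).
  by apply: perm_swap; rewrite ?(perm_uniq wD) ?(perm_mem wD) ?xyD //
     !inE eqxx ?orbT.
by do 3!apply: (perm_D) => //.
Qed.

Definition functional t m (alpha : 'I_m.+1 -> nat) :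
    {freeg (diagram m)} -> int :=
  fglift (fun D : diagram m => (mono_coef t alpha (arrows (val D))) : int^o).

HB.instance Definition _ t m alpha :=
  GRing.isZmodMorphism.Build _ int (@functional t m alpha)
    (@lift_is_additive int (diagram m) int^o _).

Lemma functional_diagram t m (alpha : 'I_m.+1 -> nat) D :
  functional t alpha << D >> = mono_coef t alpha (arrows (val D)).
Proof. by rewrite /functional liftU scale1r. Qed.

Lemma functional_word t m (alpha : 'I_m.+1 -> nat) (w : seq (endpoint m)) :
  gauss w ->
  functional t alpha << diagram_of w >> = mono_coef t alpha (arrows w).
Proof.
move=> w_gauss; rewrite functional_diagram val_diagram_of // arrows_normalize.
by apply: mono_coef_map.
Qed.

(** Each relation turns into a statement on the multisets of arrows; both sides
    of the third one have the same multisets. *)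
Lemma functional_relator t m (alpha : 'I_m.+1 -> nat) x :
  alpha ord_max = 0%N -> (\sum_i alpha i <= t)%N -> relator t x ->
  functional t alpha x = 0.
Proof.
move=> max0 le_t.
have le_i i : (alpha i <= t)%N.
  by apply: leq_trans le_t; rewrite (bigD1 i) //= leq_addr.
have dropE (w : seq (endpoint m)) a : gauss w ->
    functional t alpha << remove w a >> =
    mono_coef t alpha [seq c <- arrows w | c != a].
  move=> w_gauss; rewrite functional_word ?gauss_remove //.
  by rewrite (@arrows_filter m w (predC1 a)).
case=> {x} [D a /adjacent_mem/andP[/mem_arrows /= aD _] a_max
           |D a b ab |D a b c abc w w'|D lt_t].
- rewrite functional_diagram; apply: (@mono_coef_eq0 _ _ _ _ ord_max).
  by rewrite max0 -has_count; apply/hasP; exists a => //; apply/eqP.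
- have D_gauss : gauss (val D) by case: D {ab} => w /= /andP[].
  case/and4P: ab => ab_s /eqP ab_l /adjacent_mem/andP[]; rewrite /tl.
  move=> /mem_arrows /= aD /mem_arrows /= bD _.
  have nab : a != b by apply: contraNneq ab_s => ->.
  have s_uniq : uniq (arrows (val D)) := undup_uniq _.
  rewrite !raddfD /= !dropE // functional_diagram.
  have := mono_coef_Q2 [seq c <- arrows (val D) | c \notin [:: a; b]]
    le_i ab_s ab_l.
  set s := arrows (val D) in aD bD s_uniq *; set r := filter _ _.
  have r_uniq : uniq r by exact: filter_uniq.
  have perm_ab : perm_eq s [:: a, b & r].
    apply: uniq_perm => //= [|c].
      by rewrite !inE !mem_filter !inE !eqxx (negPf nab) orbT.
    rewrite !inE mem_filter !inE negb_or.
    by case: (eqVneq c a) => [-> //|_]; case: (eqVneq c b) => [->|_].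
  have perm_a : perm_eq [seq c <- s | c != a] (b :: r).
    rewrite (perm_trans (perm_filter _ perm_ab)) //= eqxx eq_sym nab /=.
    rewrite perm_cons (all_filterP _) //; apply/allP=> c.
    by rewrite mem_filter !inE negb_or => /andP[/andP[]].
  have perm_b : perm_eq [seq c <- s | c != b] (a :: r).
    rewrite (perm_trans (perm_filter _ perm_ab)) //= eqxx nab /=.
    rewrite perm_cons (all_filterP _) //; apply/allP=> c.
    by rewrite mem_filter !inE negb_or => /andP[/andP[]].
  rewrite (mono_coef_perm _ _ perm_ab) (mono_coef_perm _ _ perm_a).
  by rewrite (mono_coef_perm _ _ perm_b).
- have w_gauss : gauss w by rewrite /w; case: (D) => v /= /andP[].
  have w'_gauss : gauss w' := gauss_Q3_word abc.
  have ww' : perm_eq (arrows w) (arrows w').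
    apply: uniq_perm; rewrite ?undup_uniq // => d; rewrite !mem_undup.
    by apply/esym/perm_mem/perm_map/perm_Q3_word.
  rewrite raddfB !raddfD /= !dropE // functional_diagram functional_word //.
  rewrite (mono_coef_perm _ _ ww') !(mono_coef_perm _ _ (perm_filter _ ww')).
  by ring.
- by rewrite functional_diagram; apply: mono_coef_big.
Qed.

Fixpoint isolated_word m (ls : seq 'I_m.+1) : seq (endpoint m) :=
  if ls is l :: ls' then
    let a := (size ls', true, l) in
    [:: (a, true), (a, false) & isolated_word ls']
  else [::].

Lemma wellformed_isolated_word m (ls : seq 'I_m.+1) :
  wellformed (size ls) (isolated_word ls).
Proof.
elim: ls => //= l ls IHls.
have aw := wellformed_fresh_arrow true l IHls.
case/and3P: IHls => w_gauss /eqP sz_w w_lt.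
rewrite /wellformed (@gauss_cons2 _ _ _ true) aw w_gauss /= sz_w eqxx.
by rewrite /name /= ltnSn /=; apply: sub_all w_lt => x /ltnW.
Qed.

Lemma mono_coef_isolated t m (alpha : 'I_m.+1 -> nat) (ls : seq 'I_m.+1) :
  mono_coef t alpha (arrows (isolated_word ls)) =
  [forall i, alpha i == count_mem i ls]%:R.
Proof.
have seriesE i : series t i (arrows (isolated_word ls)) = 'X ^+ count_mem i ls.
  elim: ls => [|l ls IHls]; first by rewrite /series big_nil.
  have aw := wellformed_fresh_arrow true l (wellformed_isolated_word ls).
  rewrite /arrows /= inE eqxx -/(arrows _); move: aw; rewrite mem_undup => aw.
  rewrite /= (negPf aw) -/(arrows _).
  rewrite /series big_cons -/(series _ _ _) IHls /= /label /=.
  by case: eqP => _; rewrite ?add0n // exprS /weight /= mulr1.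
rewrite /mono_coef; under eq_bigr do rewrite seriesE coefXn.
case: (boolP [forall i, _]) => [/forallP eq_a|/forallPn[i /negPf ne_a]].
  by rewrite big1 // => i _; rewrite eq_a.
by rewrite (bigD1 i) //= ne_a mul0r.
Qed.

(** The default value is the exponent 0 of the maximal label, whose index m lies
    just beyond the tuple. *)
Definition exponent t m (v : m.-tuple 'I_t.+1) (i : 'I_m.+1) : nat :=
  nth ord0 v i.

Definition labels m (alpha : 'I_m.+1 -> nat) : seq 'I_m.+1 :=
  flatten [seq nseq (alpha i) i | i <- enum 'I_m.+1].

Lemma count_labels m (alpha : 'I_m.+1 -> nat) i :
  count_mem i (labels alpha) = alpha i.
Proof.
rewrite /labels count_flatten -map_comp sumnE big_map big_enum /=.
rewrite (bigD1 i) //= count_nseq /= eqxx mul1n big1 ?addn0 // => j nji.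
by rewrite count_nseq /= (negPf nji).
Qed.

(** The functional of one exponent vector is 1 on the diagram of isolated arrows
    with these multiplicities of labels and 0 on the others, and it vanishes on
    the relations. *)
Lemma independent_isolated t m :
  exists v : 'I_'C(m + t, m) -> X t m, independent v.
Proof.
rewrite -card_partial_ord_partitions; set T := [set _ | _].
pose word (v : m.-tuple 'I_t.+1) := isolated_word (labels (exponent v)).
exists (fun i => class t (word (enum_val i))) => c c_rel i.
pose x : {freeg (diagram m)} :=
  \sum_j << diagram_of (word (enum_val j)) >> *~ c j.
have x_rel : x \in subgroup (@relator t m).
  rewrite -pi_eq0 /x raddf_sum -[X in _ == X]c_rel; apply/eqP/eq_bigr => j _.
  by rewrite raddfMz.
pose alpha := exponent (enum_val i).
have alpha_max : alpha ord_max = 0%N.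
  by rewrite /alpha /exponent nth_default // size_tuple.
have alpha_sum : (\sum_j alpha j <= t)%N.
  have := enum_valP i; rewrite inE; apply: leq_trans.
  rewrite big_ord_recr /= alpha_max addn0 (big_nth ord0) size_tuple big_mkord.
  by apply: eq_leq; apply: eq_bigr => j _.
have := x_rel => /asboolP[s s_rel x_s].
have : functional t alpha x = 0.
  rewrite x_s raddf_sum big_seq big1 // => p /s_rel p_rel.
  by rewrite raddfMz /= functional_relator // mul0rz.
rewrite /x raddf_sum (bigD1 i) //= big1 => [|j nji]; last first.
  rewrite raddfMz /= functional_word; last first.
    by case/and3P: (wellformed_isolated_word (labels (exponent (enum_val j)))).
  rewrite mono_coef_isolated.
  case: forallP => [eq_a|_]; last by rewrite mul0rz.
  case/eqP: nji; apply/esym/enum_val_inj/eq_from_tnth => k.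
  have /eqP := eq_a (widen_ord (leqnSn m) k); rewrite count_labels.
  by rewrite /alpha /exponent /= -!tnth_nth => /ord_inj.
rewrite addr0 raddfMz /= functional_word; last first.
  by case/and3P: (wellformed_isolated_word (labels (exponent (enum_val i)))).
rewrite mono_coef_isolated (introT forallP) => [|j].
  by rewrite intz.
by rewrite count_labels.
Qed.

(** * The bounds on the rank *)

Lemma has_rank_bounded (V : zmodType) N r0 :
  (forall n (v : 'I_n -> V), independent v -> (n <= N)%N) ->
  (exists v : 'I_r0 -> V, independent v) ->
  exists2 r, has_rank V r & (r0 <= r <= N)%N.
Proof.
move=> le_N ex_r0; pose P n := `[< exists v : 'I_n -> V, independent v >].
have exP : exists n, P n by exists r0; apply/asboolP.
have leP n : P n -> (n <= N)%N by move=> /asboolP[v /le_N].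
case: (ex_maxnP exP leP) => r /asboolP ex_r max_r; exists r.
  by split=> // n v v_ind; apply: max_r; apply/asboolP; exists v.
by rewrite max_r ?leP //; apply/asboolP.
Qed.

Lemma size_spanning_words t m :
  size (spanning_words t m) =
  (\sum_(k < t.+1) count (fun w => cuts w == 0%N) (positive_words m k))%N.
Proof.
rewrite size_flatten /shape -map_comp sumnE big_map -(big_mkord xpredT
  (fun k => count (fun w => cuts w == 0%N) (positive_words m k))).
rewrite /index_iota subn0.
by apply: eq_bigr => k _; rewrite /= size_filter.
Qed.

(** The top degree is bounded by its bracket in Omega.  In degrees 2 to t - 1
    Omega has 2^(2k) in place of 2^k, and 4m covers degrees 0 and 1. *)
Lemma size_spanning_words_Omega t m : (0 < t)%N -> (0 < m)%N ->
  (size (spanning_words t m))%:Z <= Omega t m.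
Proof.
move=> t_gt0 m_gt0; pose B (k : nat) : nat :=
  count (fun w => cuts w == 0%N) (positive_words m k).
pose bad e k : nat := (\sum_(1 <= j < ((2 * k + 1) %/ 3).+1)
  'C(2 * (k - j) + 1, j) * odd_dfact (k - j) * 2 ^ e * m ^ (k - j))%N.
pose all_words e k : nat := (odd_dfact k * 2 ^ e * m.+1 ^ k)%N.
have B_le e k : (k <= e)%N -> (B k + bad e k <= all_words e k)%N.
  move=> le_ke; have := leq_mul (leqnn (2 ^ (e - k))) (count_cutfree m k).
  rewrite -/(B k) mulnDr big_distrr /=.
  have pow2 : (2 ^ e = 2 ^ (e - k) * 2 ^ k)%N by rewrite -expnD subnK.
  rewrite /all_words pow2 [in leqRHS]mulnCA !mulnA => le_B.
  apply: leq_trans (leq_trans le_B _); last by apply: eq_leq; ring.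
  apply: leq_add; first by rewrite leq_pmull ?expn_gt0.
  by apply: eq_leq; apply: eq_bigr => j _; rewrite pow2; ring.
have posz_sum (a b : nat) F :
    (\sum_(a <= k < b) F k)%N%:Z = \sum_(a <= k < b) (F k)%:Z.
  by apply: (big_morph Posz PoszD).
have -> : Omega t m = (4 * m)%N%:Z + (all_words t t)%:Z - (bad t t)%:Z
    + (\sum_(2 <= k < t) all_words (2 * k) k)%N%:Z
    - (\sum_(2 <= k < t) bad (2 * k) k)%N%:Z.
  rewrite /Omega !posz_sum; congr (_ - _).
  by apply: eq_bigr => k _; rewrite posz_sum.
have low : (\sum_(k < t) B k + \sum_(2 <= k < t) bad (2 * k) k
            <= 4 * m + \sum_(2 <= k < t) all_words (2 * k) k)%N.
  rewrite -(big_mkord xpredT B).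
  have B0 : B 0%N = 1%N by [].
  case: t t_gt0 => [|[|t]] // _; first by rewrite big_nat1 !big_geq // B0; lia.
  have B1 : (B 1%N <= 2 * m)%N.
    have := B_le 1%N 1%N (leqnn _); rewrite /bad big_nat1 /all_words.
    rewrite /odd_dfact big_ord_recr !big_ord0 /=.
    by rewrite subnn !expn0 !expn1 muln0 bin1; lia.
  rewrite 2?big_ltn // B0 addnA -addnA -big_split /=.
  apply: leq_add; first by lia.
  rewrite big_nat [leqRHS]big_nat; apply: leq_sum => k _.
  by apply: B_le; lia.
rewrite size_spanning_words big_ord_recr /= -/(B t).
have := B_le t t (leqnn t).
move: low; rewrite -[\sum_(k < t) _]/(\sum_(k < t) B k)%N.
move: (\sum_(k < t) B k)%N (\sum_(2 <= k < t) _)%N (\sum_(2 <= k < t) _)%N.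
by move=> *; lia.
Qed.

Theorem mainTheorem12 (t m : nat) (ht : (0 < t)%N) (hm : (0 < m)%N) :
  exists2 rho : nat, has_rank (X t m) rho &
    t.+1%:R / m%:R * 'C(m + t, 1 + t)%:R <= rho%:R :> rat /\
    rho%:Z <= Omega t m.
Proof.
have le_N n (v : 'I_n -> X t m) :
    independent v -> (n <= size (spanning_words t m))%N.
  rewrite -(size_map (@class t m)); apply: independent_leq_span.
  apply: class_span_cutfree => w w_span; apply: subgroup_gen.
  exact: map_f.
have [rho rho_rank /andP[ge_rho le_rho]] :=
  has_rank_bounded le_N (independent_isolated t m).
exists rho => //; split; last first.
  by apply: le_trans (size_spanning_words_Omega ht hm); rewrite lez_nat.
have -> : t.+1%:R / m%:R * 'C(m + t, 1 + t)%:R = 'C(m + t, m)%:R :> rat.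
  have m_neq0 : m%:R != 0 :> rat by rewrite pnatr_eq0 -lt0n.
  apply: (mulfI m_neq0); rewrite mulrA mulrCA divff // mulr1 -!natrM.
  by rewrite add1n mul_bin_left addnK -bin_sub ?leq_addl // addnK.
by rewrite ler_nat.
Qed.
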